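(* The functions $M_{i,j,k}$ on $\mathrm{GL}_n^3$ satisfy the geometric octahedron recurrence: for all integers $i,j,k$, $$M_{i+1,j,k+1}M_{i,j+1,k}=M_{i,j+1,k+1}M_{i+1,j,k}+M_{i,j,k+1}M_{i+1,j+1,k},$$ where $M_{i,j,k}=0$ if $(i,j,k)\notin\Delta^3(n)$. Moreover, each $M_{i,j,k}$ with $(i,j,k)\in\Delta^3(n)$ is expressible both as a rational function of the functions $M_{i',j',k'}$ with $(i',j',k')\in\Delta^3(n)$ on the faces $\mathcal F_0=\{k'=0\}$ and $\mathcal F_1=\{i'=0\}$, and as a rational function of the functions $M_{i',j',k'}$ with $(i',j',k')\in\Delta^3(n)$ on the other two faces $\{j'=0\}$ and $\{i'+j'+k'=n\}$.
   Context: $\mathrm{GL}_n$ is the group of invertible complex $n\times n$ matrices. $\Delta^3(n)=\{(i,j,k)\in\mathbb Z_{\ge0}^3:i+j+k\le n\}$. $[1,k]=\{1,\dots,k\}$ (empty if $k\le0$), $I+b=\{a+b:a\in I\}$, and $\Delta_{I,J}(g)$ is the minor of $g$ with rows $I$ and columns $J$. For $(g_1,g_2,g_3)\in\mathrm{GL}_n^3$ let $\boldsymbol g=[\,\mathrm{Id}_n\ \ g_1\ \ g_1g_2\ \ g_1g_2g_3\,]$, an $n\times 4n$ matrix. For $(i,j,k)\in\Delta^3(n)$ the multi-corner minor is $$M_{i,j,k}(g_1,g_2,g_3)=\Delta_{[1,n],J}(\boldsymbol g),\quad J=[1,n-i-j-k]\cup([1,i]+n)\cup([1,j]+2n)\cup([1,k]+3n).$$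 *)

(* Defs.v *)
From HB Require Import structures.
From mathcomp Require Import all_boot all_order all_algebra.
From mathcomp Require Import reals.
From mathcomp Require Import complex mpoly.

Set Implicit Arguments.
Unset Strict Implicit.
Unset Printing Implicit Defensive.

Import Order.TTheory GRing.Theory Num.Theory.

Local Open Scope ring_scope.

Definition GL (K : fieldType) (n : nat) := {g : 'M[K]_n | g \in unitmx}.

Definition GL3 (K : fieldType) (n : nat) := (GL K n * GL K n * GL K n)%type.

(* The submatrix keeps the rows in I and the columns in J in increasing order,
   which is the order in which enum_val lists a set of ordinals. *)
Definition minor (K : fieldType) (m p : nat) (A : 'M[K]_(m, p))
    (I : {set 'I_m}) (J : {set 'I_p}) : K :=
  if #|I| =P #|J| is ReflectT eqIJ then
    \det (\matrix_(a < #|I|, b < #|I|)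
            A (enum_val a) (enum_val (cast_ord eqIJ b)))
  else 0.

(* [1, k] + b: ordinals number columns from 0, so these are b, ..., b + k - 1. *)
Definition interval_from (p b k : nat) : {set 'I_p} :=
  [set c : 'I_p | (b <= c < b + k)%N].

Definition bigmx (K : fieldType) (n : nat) (g : GL3 K n)
    : 'M[K]_(n, n + n + n + n) :=
  let: (g1, g2, g3) := g in
  row_mx (row_mx (row_mx 1%:M (val g1)) (val g1 *m val g2))
         (val g1 *m val g2 *m val g3).

Definition columns (n i j k : nat) : {set 'I_(n + n + n + n)} :=
  interval_from _ 0 (n - i - j - k) :|: interval_from _ n i
    :|: interval_from _ (2 * n) j :|: interval_from _ (3 * n) k.

Definition in_Delta3 (n : nat) (i j k : int) : bool :=
  [&& 0 <= i, 0 <= j, 0 <= k & i + j + k <= n%:Z].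

Definition M (K : fieldType) (n : nat) (i j k : int) (g : GL3 K n) : K :=
  if in_Delta3 n i j k then
    minor (bigmx g) [set: 'I_n] (columns n `|i|%N `|j|%N `|k|%N)
  else 0.

(* A finite type containing Delta^3(n), whose coordinates are at most n. *)
Definition cube (n : nat) : finType := ('I_n.+1 * 'I_n.+1 * 'I_n.+1)%type.

Definition M_at (K : fieldType) (n : nat) (t : cube n) : GL3 K n -> K :=
  M (t.1.1 : nat)%:Z (t.1.2 : nat)%:Z (t.2 : nat)%:Z.

Definition faces_k0_i0 (n : nat) : {set cube n} :=
  [set t : cube n | (t.1.1 + t.1.2 + t.2 <= n)%N
     && ((t.2 == 0 :> nat) || (t.1.1 == 0 :> nat))].

Definition faces_j0_sum (n : nat) : {set cube n} :=
  [set t : cube n | (t.1.1 + t.1.2 + t.2 <= n)%N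
     && ((t.1.2 == 0 :> nat) || (t.1.1 + t.1.2 + t.2 == n)%N)].

(* f = P / Q in the functions (h t), t in F, for polynomials P and Q in one
   variable per element of F. The denominator is required not to vanish
   identically on X, rather than only to be a nonzero polynomial; as GL_n^3 is
   irreducible, the equality then holds on a dense open subset of it. *)
Definition rational_function_of (K : fieldType) (X : Type) (T : finType)
    (F : {set T}) (h : T -> X -> K) (f : X -> K) : Prop :=
  exists P Q : {mpoly K[#|F|]},
    let ev (S : {mpoly K[#|F|]}) (x : X) := S.@[fun a => h (enum_val a) x] in
    (exists x, ev Q x != 0) /\
    (forall x, ev Q x != 0 -> f x = ev P x / ev Q x).

(* Main.v *)
(* The recurrence is a three-term Pluecker relation: with a, b, c, d the next
   column of each of the four blocks and s the columns common to all terms, it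
   reads <ac><bd> = <ab><cd> + <ad><bc>, where <xy> = det (x, y, s); bringing the
   columns into increasing order costs the same sign in each of the three terms.
   Solving the recurrence for M_{i+1,j,k+1}, resp. M_{i,j+1,k}, expresses it
   through entries with smaller i + k, resp. smaller j - (i + j + k), until the
   faces are reached. The denominators do not vanish identically because all the
   M_{i,j,k} are nonzero at one common point, coming from a Vandermonde matrix. *)

Require Import Defs.
From HB Require Import structures.
From mathcomp Require Import all_boot all_order all_algebra.
From mathcomp Require Import reals.
From mathcomp Require Import complex mpoly.
From mathcomp Require Import zify ring.

Set Implicit Arguments.
Unset Strict Implicit.
Unset Printing Implicit Defensive.

Import Order.TTheory GRing.Theory Num.Theory.

Local Open Scope ring_scope.

(** * Determinants of lists of columns and the three-term Plücker relation *)

Definition mx_of_cols (K : fieldType) (n m : nat) (s : seq 'cV[K]_n) : 'M[K]_(n, m) :=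
  \matrix_(a, b) s`_b a 0.

Definition det_cols (K : fieldType) (n : nat) (s : seq 'cV[K]_n) : K :=
  \det (mx_of_cols n s).

Lemma nth_cat_bump (T : Type) (x0 : T) (s t : seq T) (x : T) (k : nat) :
  nth x0 (s ++ x :: t) (bump (size s) k) = nth x0 (s ++ t) k.
Proof.
rewrite !nth_cat /bump; case: (leqP (size s) k) => h.
  by rewrite add1n ltnNge leqW //= subSn.
by rewrite add0n h.
Qed.

Lemma col'_mx_of_cols (K : fieldType) (n m : nat) (s t : seq 'cV[K]_n) x (j : 'I_m.+1) :
  j = size s :> nat ->
  col' j (mx_of_cols m.+1 (s ++ x :: t)) = mx_of_cols m (s ++ t).
Proof. by move=> hj; apply/matrixP=> a b; rewrite !mxE /= hj nth_cat_bump. Qed.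

(** For [s] of length [n], this is the row vector of the linear form [x] |-> [det_cols (x :: s)], a
    generalized cross product. *)
Definition cofactor_row (K : fieldType) (n : nat) (s : seq 'cV[K]_n.+1) : 'rV[K]_n.+1 :=
  \row_a ((-1) ^+ a * \det (row' a (mx_of_cols n s))).

Lemma det_cols_expand (K : fieldType) (n : nat) (s t : seq 'cV[K]_n.+1) x :
  (size s <= n)%N ->
  det_cols (s ++ x :: t) = (-1) ^+ size s * (cofactor_row (s ++ t) *m x) 0 0.
Proof.
move=> hs; have hs' : (size s < n.+1)%N by [].
rewrite /det_cols (expand_det_col _ (Ordinal hs')) mxE mulr_sumr.
apply: eq_bigr => a _; rewrite /cofactor col'_mx_of_cols // !mxE.
by rewrite /= nth_cat ltnn subnn /= exprD; ring.
Qed.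

(** Expanding either side along [x] gives the same [cofactor_row (s ++ t)]; only the position of [x]
    contributes a sign. *)
Lemma det_cols_move (K : fieldType) (n : nat) (s t : seq 'cV[K]_n.+1) x :
  (size s <= n)%N ->
  det_cols (s ++ x :: t) = (-1) ^+ size s * det_cols (x :: s ++ t).
Proof.
by move=> hs; rewrite det_cols_expand // -(cat0s (x :: _)) det_cols_expand //= mul1r.
Qed.

Lemma det_cols_dup (K : fieldType) (n : nat) (s : seq 'cV[K]_n) (i j : nat) :
  (i < j < n)%N -> s`_i = s`_j -> det_cols s = 0.
Proof.
move=> /andP[ij jn] e; rewrite /det_cols -det_tr.
have := @determinant_alternate _ _ (mx_of_cols n s)^T
  (Ordinal (ltn_trans ij jn)) (Ordinal jn).
by apply=> [|a]; [rewrite -val_eqE /= ltn_eqF | rewrite !mxE e].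
Qed.

(* The columns (l v ; v), for v among b, c, d and s, are linearly dependent when
   l is the linear form v |-> det (v, a, s); the relation is the expansion of
   their determinant along the row of values of l. *)
Lemma plucker3 (K : fieldType) (n : nat) (a b c d : 'cV[K]_n) (s : seq 'cV[K]_n) :
  (size s).+2 = n ->
  det_cols (a :: c :: s) * det_cols (b :: d :: s) =
  det_cols (a :: b :: s) * det_cols (c :: d :: s) +
  det_cols (a :: d :: s) * det_cols (b :: c :: s).
Proof.
move=> hn; case: n a b c d s hn => [//|[//|n]] a b c d s [hs].
pose u := cofactor_row (a :: s).
pose v := b :: c :: d :: s.
pose V := mx_of_cols n.+3 v.
have lamE (x : 'cV_n.+2) : (u *m x) 0 0 = - det_cols (a :: x :: s).
  rewrite -[a :: x :: s]/([:: a] ++ x :: s) det_cols_expand //= expr1.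
  by rewrite mulN1r opprK.
pose W : 'M[K]_n.+3 := col_mx (u *m V) V.
have W0 j : W 0 j = - det_cols (a :: v`_j :: s).
  have -> : W 0 j = (u *m V) 0 j.
    by rewrite -(col_mxEu (u *m V) V); congr (W _ _); apply/val_inj.
  rewrite -lamE !mxE; apply: eq_bigr => k _.
  by rewrite !mxE.
have rW : row' 0 W = V.
  apply/matrixP=> i j; rewrite !mxE /=.
  by case: splitP => [k | k]; [rewrite ord1 | rewrite !mxE /= => -[/val_inj ->]].
have cW s1 x s2 (j : 'I_n.+3) : v = s1 ++ x :: s2 -> j = size s1 :> nat ->
    cofactor W 0 j = (-1) ^+ j * det_cols (s1 ++ s2).
  move=> ev ej; rewrite /cofactor add0n; congr (_ * \det _).
  by rewrite -(@col'_mx_of_cols _ _ _ s1 s2 x j) // -ev -/V -rW; apply/matrixP=> p q; rewrite !mxE.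
have: \det W = 0.
  (* The top row of [W] is [u *m V], so [(1, -u)] lies in the left kernel of [W]. *)
  apply/eqP/det0P; exists (row_mx 1%:M (- u) : 'M_(1, 1 + n.+2)).
    apply/eqP=> /(congr1 (@lsubmx _ 1 1 n.+2)).
    by rewrite row_mxKl => /rowP/(_ 0)/eqP; rewrite !mxE oner_eq0.
  have := mul_row_col (1%:M : 'M_1) (- u) (u *m V) V.
  by rewrite mul1mx mulNmx subrr.
rewrite (expand_det_row _ 0) 3!big_ord_recl big1 => [|i _].
  rewrite !W0 /= (cW [::] b (c :: d :: s)) // (cW [:: b] c (d :: s)) //.
  rewrite (cW [:: b; c] d s) //= /bump /= => h.
  by apply/eqP; rewrite -subr_eq0 -[0]h; apply/eqP; ring.
rewrite W0 /= (@det_cols_dup _ _ _ 1 i.+2) ?oppr0 ?mul0r //=.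
by rewrite !ltnS ltn_ord.
Qed.

(** First [y] passes [size s + 1 + size t] columns, then [x] passes [size s + 1]; modulo 2 only
    [size t] remains. *)
Lemma det_cols_move2 (K : fieldType) (n : nat) (s t r : seq 'cV[K]_n) x y :
  size (s ++ x :: t ++ y :: r) = n ->
  det_cols (s ++ x :: t ++ y :: r) =
  (-1) ^+ size t * det_cols (x :: y :: s ++ t ++ r).
Proof.
rewrite !size_cat /= size_cat /=; case: n s t r x y => [|n] s t r x y hs.
  by move: hs; lia.
rewrite -cat_cons catA det_cols_move; last by rewrite size_cat /=; lia.
rewrite -catA -(cat_cons y) det_cols_move /=; last by lia.
rewrite mulrA -exprD size_cat /= -signr_odd -[in RHS]signr_odd.
by congr (_ ^+ _ * _); congr nat_of_bool; lia.
Qed.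

Lemma plucker_blocks (K : fieldType) (n : nat) (s1 s2 s3 s4 : seq 'cV[K]_n) a b c d :
  (size (s1 ++ s2 ++ s3 ++ s4)).+2 = n ->
  det_cols (s1 ++ (s2 ++ [:: b]) ++ s3 ++ (s4 ++ [:: d]))
    * det_cols ((s1 ++ [:: a]) ++ s2 ++ (s3 ++ [:: c]) ++ s4) =
  det_cols (s1 ++ s2 ++ (s3 ++ [:: c]) ++ (s4 ++ [:: d]))
    * det_cols ((s1 ++ [:: a]) ++ (s2 ++ [:: b]) ++ s3 ++ s4) +
  det_cols ((s1 ++ [:: a]) ++ s2 ++ s3 ++ (s4 ++ [:: d]))
    * det_cols (s1 ++ (s2 ++ [:: b]) ++ (s3 ++ [:: c]) ++ s4).
Proof.
move=> hs; set s := s1 ++ s2 ++ s3 ++ s4 in hs.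
have move2 r1 r2 r3 x y : r1 ++ r2 ++ r3 = s ->
    det_cols (r1 ++ x :: r2 ++ y :: r3) = (-1) ^+ size r2 * det_cols (x :: y :: s).
  move=> e; rewrite det_cols_move2 ?e //.
    by move: hs; rewrite -e !size_cat /= !size_cat /=; lia.
have e1 : s1 ++ (s2 ++ [:: b]) ++ s3 ++ (s4 ++ [:: d]) =
    (s1 ++ s2) ++ b :: (s3 ++ s4) ++ d :: [::] by rewrite -!catA.
have e2 : (s1 ++ [:: a]) ++ s2 ++ (s3 ++ [:: c]) ++ s4 =
    s1 ++ a :: (s2 ++ s3) ++ c :: s4 by rewrite -!catA.
have e3 : s1 ++ s2 ++ (s3 ++ [:: c]) ++ (s4 ++ [:: d]) =
    (s1 ++ s2 ++ s3) ++ c :: s4 ++ d :: [::] by rewrite -!catA.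
have e4 : (s1 ++ [:: a]) ++ (s2 ++ [:: b]) ++ s3 ++ s4 =
    s1 ++ a :: s2 ++ b :: (s3 ++ s4) by rewrite -!catA.
have e5 : (s1 ++ [:: a]) ++ s2 ++ s3 ++ (s4 ++ [:: d]) =
    s1 ++ a :: (s2 ++ s3 ++ s4) ++ d :: [::] by rewrite -!catA.
have e6 : s1 ++ (s2 ++ [:: b]) ++ (s3 ++ [:: c]) ++ s4 =
    (s1 ++ s2) ++ b :: s3 ++ c :: s4 by rewrite -!catA.
rewrite e1 e2 e3 e4 e5 e6 !move2 ?cats0 -?catA // !size_cat !exprD.
(* The common sign has exponent [size s2 + size s4]; in the first and third products [size s3]
   occurs twice and cancels. *)
have sq k : (-1) ^+ k * (-1) ^+ k = 1 :> K by rewrite -expr2 sqrr_sign.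
have h := plucker3 a b c d hs.
transitivity ((-1) ^+ size s2 * (-1) ^+ size s4 *
   ((-1) ^+ size s3 * (-1) ^+ size s3) *
   (det_cols (a :: c :: s) * det_cols (b :: d :: s))); first by ring.
rewrite h !sq mulr1 mulrDr; congr (_ + _); first by ring.
transitivity ((-1) ^+ size s2 * (-1) ^+ size s4 *
   ((-1) ^+ size s3 * (-1) ^+ size s3) *
   (det_cols (a :: d :: s) * det_cols (b :: c :: s))); last by ring.
by rewrite sq mulr1.
Qed.

(** * The minors as determinants of lists of columns *)

(** Columns are indexed by [nat], with zero columns from [p] on, so that column sets become
    concatenations of [iota] lists. *)
Definition nat_col (K : fieldType) (n p : nat) (A : 'M[K]_(n, p)) (c : nat) : 'cV[K]_n :=
  \col_a oapp (A a) 0 (insub c).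

Lemma det_cast (K : fieldType) (m n : nat) (e : m = n) (A : 'M[K]_m) (B : 'M[K]_n) :
  (forall a b, A a b = B (cast_ord e a) (cast_ord e b)) -> \det A = \det B.
Proof.
case: n / e B => B h; congr (\det _); apply/matrixP=> a b.
by rewrite h !cast_ord_id.
Qed.

(** A strictly increasing list is determined by its elements. *)
Lemma enum_set_nat (p : nat) (J : {set 'I_p}) (s : seq nat) :
  sorted ltn s -> all (fun c => (c < p)%N) s -> (forall c : 'I_p, (c \in J) = (val c \in s)) ->
  map val (enum J) = s.
Proof.
move=> hs hp hJ; apply: (irr_sorted_eq ltn_trans ltnn) => // [|c].
  apply: (subseq_sorted ltn_trans (s2 := iota 0 p)); last exact: iota_ltn_sorted.
  by rewrite -val_enum_ord enumT; apply/map_subseq; rewrite {1}/enum_mem filter_subseq.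
apply/mapP/idP => [[d + ->]|cs]; first by rewrite mem_enum hJ.
have cp := allP hp _ cs; exists (Ordinal cp) => //.
by rewrite mem_enum hJ.
Qed.

Lemma minor_det_cols (K : fieldType) (n p : nat) (A : 'M[K]_(n, p))
    (J : {set 'I_p}) (s : seq nat) :
  sorted ltn s -> all (fun c => (c < p)%N) s -> (forall c : 'I_p, (c \in J) = (val c \in s)) ->
  size s = n ->
  minor A [set: 'I_n] J = det_cols (map (nat_col A) s).
Proof.
move=> hs hp hJ hn; have es := enum_set_nat hs hp hJ.
have cI : #|[set: 'I_n]| = n by rewrite cardsT card_ord.
(* The default value 0 of [minor] is excluded, because [s] has [n] entries. *)
rewrite /minor; case: eqP => [e|[]]; last first.
  by rewrite cI -hn -es size_map cardE.
apply: (det_cast (e := cI)) => a b; rewrite !mxE.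
rewrite (nth_map 0%N) ?hn; last exact: ltn_ord.
set y := enum_val (cast_ord e b).
have -> : s`_b = val y.
  rewrite -{1}es (nth_map y); last by rewrite -cardE -e.
  by rewrite [in RHS]/y (enum_val_nth y).
rewrite mxE valK /=; congr (A _ _); apply/val_inj => /=.
have [x0 _] : exists x0 : 'I_n, true by exists (cast_ord cI a).
rewrite (enum_val_nth x0) enum_setT -enumT.
by rewrite nth_enum_ord //; exact: ltn_ord (cast_ord cI a).
Qed.

Definition column_seq (n i j k : nat) : seq nat :=
  iota 0 (n - i - j - k) ++ iota n i ++ iota (2 * n) j ++ iota (3 * n) k.

Lemma size_column_seq (n i j k : nat) :
  (i + j + k <= n)%N -> size (column_seq n i j k) = n.
Proof. by rewrite /column_seq !size_cat !size_iota; lia. Qed.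

Lemma sorted_column_seq (n i j k : nat) :
  (i + j + k <= n)%N -> sorted ltn (column_seq n i j k).
Proof.
move=> h; rewrite (sorted_pairwise ltn_trans) !pairwise_cat.
rewrite -!(sorted_pairwise ltn_trans) !iota_ltn_sorted /= !andbT.
by apply/and3P; split; apply/allrelP=> x y; rewrite ?mem_cat !mem_iota /=; lia.
Qed.

Lemma column_seq_bound (n i j k : nat) :
  (i + j + k <= n)%N -> all (fun c => (c < n + n + n + n)%N) (column_seq n i j k).
Proof. by move=> h; apply/allP=> x; rewrite !mem_cat !mem_iota => hx /=; lia. Qed.

Lemma M_det_cols (K : fieldType) (n i j k : nat) (g : GL3 K n) :
  (i + j + k <= n)%N ->
  M i j k g = det_cols (map (nat_col (bigmx g)) (column_seq n i j k)).
Proof.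
move=> h; rewrite /M ifT; last by apply/and4P; split=> //; lia.
apply: minor_det_cols; last exact: size_column_seq.
- exact: sorted_column_seq.
- exact: column_seq_bound.
- by move=> c; rewrite !inE !mem_cat !mem_iota !orbA.
Qed.

(** * The octahedron recurrence *)

Lemma octahedron_nat (K : fieldType) (n i j k : nat) (g : GL3 K n) :
  (i + j + k + 2 <= n)%N ->
  M i.+1 j k.+1 g * M i j.+1 k g =
  M i j.+1 k.+1 g * M i.+1 j k g + M i j k.+1 g * M i.+1 j.+1 k g.
Proof.
move=> h; rewrite !M_det_cols; try lia.
(* Every minor below has blocks of lengths [l], [i], [j], [k] with exactly two of them one column
   longer, as in [plucker_blocks]. *)
have [l hl] : exists l, (n = l + i + j + k + 2)%N by exists (n - (i + j + k + 2))%N; lia.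
rewrite /column_seq.
have -> : (n - i.+1 - j - k.+1 = l)%N by lia.
have -> : (n - i - j.+1 - k.+1 = l)%N by lia.
have -> : (n - i.+1 - j.+1 - k = l)%N by lia.
have -> : (n - i - j.+1 - k = l + 1)%N by lia.
have -> : (n - i.+1 - j - k = l + 1)%N by lia.
have -> : (n - i - j - k.+1 = l + 1)%N by lia.
rewrite -(addn1 i) -(addn1 j) -(addn1 k) !iotaD !map_cat.
by apply: plucker_blocks; rewrite !size_cat !size_map !size_iota; lia.
Qed.

Lemma M_mul_out (K : fieldType) (n : nat) (i j k i' j' k' : int) (g : GL3 K n) :
  ~~ (in_Delta3 n i j k && in_Delta3 n i' j' k') -> M i j k g * M i' j' k' g = 0.
Proof. by rewrite /M; do 2![case: ifP => _] => //; rewrite ?mul0r ?mulr0. Qed.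

Lemma octahedron (K : fieldType) (n : nat) (i j k : int) (g : GL3 K n) :
  M (i + 1) j (k + 1) g * M i (j + 1) k g =
  M i (j + 1) (k + 1) g * M (i + 1) j k g
  + M i j (k + 1) g * M (i + 1) (j + 1) k g.
Proof.
have [/and4P[] | out] := boolP [&& 0 <= i, 0 <= j, 0 <= k & i + j + k + 2 <= n%:Z].
  case: i j k => [i|//] [j|//] [k|//] _ _ _ h.
  by rewrite -!PoszD !addn1 octahedron_nat //; lia.
(* If [i], [j] or [k] is negative, or [i + j + k + 2 > n], each of the three products has a factor
   indexed outside Delta^3(n). *)
by rewrite !M_mul_out ?addr0 // /in_Delta3; lia.
Qed.

(** * A point where no multi-corner minor vanishes *)

(** In the form [colsub f], selecting columns commutes with left multiplication; injectivity of [f]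
    keeps Vandermonde nodes distinct. *)
Lemma colsub_of_seq (n p : nat) (s : seq nat) :
  uniq s -> all (fun c => (c < p)%N) s -> size s = n ->
  exists2 f : 'I_n -> 'I_p, injective f &
    forall (K : fieldType) (A : 'M[K]_(n, p)),
      mx_of_cols n (map (nat_col A) s) = colsub f A.
Proof.
move=> us ps sn; have hs (b : 'I_n) : (nth 0 s b < p)%N.
  by apply: (allP ps); apply: mem_nth; rewrite sn.
exists (fun b => Ordinal (hs b)) => [b b' /(congr1 val)/eqP /=|K A].
  by rewrite nth_uniq ?sn // => /eqP/val_inj.
apply/matrixP=> a b; rewrite !mxE (nth_map 0%N) ?sn // mxE.
by rewrite (insubT (fun c => (c < p)%N) (hs b)).
Qed.

Lemma Vandermonde_unit (K : fieldType) (n : nat) (a : 'rV[K]_n) :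
  injective (a 0) -> Vandermonde n a \in unitmx.
Proof.
move=> inj_a; rewrite unitmxE det_Vandermonde unitfE.
apply/prodf_neq0 => i _; apply/prodf_neq0 => j ij.
by rewrite subr_eq0 (inj_eq inj_a) -val_eqE gtn_eqF.
Qed.

(* For a Vandermonde matrix V = [V0 V1 V2 V3], all the maximal minors of
   V0^-1 V = [1 A B C] are nonzero, and g1 = A, g2 = A^-1 B, g3 = B^-1 C. *)
Lemma generic_point (K : numFieldType) (n : nat) :
  exists g : GL3 K n,
    forall i j k : nat, (i + j + k <= n)%N -> M i j k g != 0.
Proof.
(* The nodes 0, 1, ..., 4n - 1 are distinct in [K], which has characteristic 0. *)
pose a : 'rV[K]_(n + n + n + n) := \row_j (j : nat)%:R.
pose V := Vandermonde n a.
have Vunit (f : 'I_n -> 'I_(n + n + n + n)) : injective f -> colsub f V \in unitmx.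
  move=> inj_f; have -> : colsub f V = Vandermonde n (\row_j a 0 (f j)).
    by apply/matrixP=> i j; rewrite !mxE.
  apply: Vandermonde_unit => i j; rewrite !mxE => /eqP.
  by rewrite eqr_nat => /eqP/val_inj/inj_f.
pose V0 := lsubmx (lsubmx (lsubmx V)); pose V1 := rsubmx (lsubmx (lsubmx V)).
pose V2 := rsubmx (lsubmx V); pose V3 := rsubmx V.
have uV0 : V0 \in unitmx.
  have -> : V0 = colsub (lshift n \o lshift n \o lshift n) V.
    by apply/matrixP=> i j; rewrite !mxE.
  by apply: Vunit; do 2?apply: inj_comp; exact: lshift_inj.
have uV1 : V1 \in unitmx.
  have -> : V1 = colsub (lshift n \o lshift n \o @rshift n n) V.
    by apply/matrixP=> i j; rewrite !mxE.
  by apply: Vunit; do 2?apply: inj_comp; (exact: lshift_inj || exact: rshift_inj).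
have uV2 : V2 \in unitmx.
  have -> : V2 = colsub (lshift n \o @rshift (n + n) n) V.
    by apply/matrixP=> i j; rewrite !mxE.
  by apply: Vunit; apply: inj_comp; (exact: lshift_inj || exact: rshift_inj).
have uV3 : V3 \in unitmx.
  have -> : V3 = colsub (@rshift (n + n + n) n) V.
    by apply/matrixP=> i j; rewrite !mxE.
  by apply: Vunit; exact: rshift_inj.
have ug1 : invmx V0 *m V1 \in unitmx by rewrite unitmx_mul unitmx_inv uV0.
have ug2 : invmx V1 *m V2 \in unitmx by rewrite unitmx_mul unitmx_inv uV1.
have ug3 : invmx V2 *m V3 \in unitmx by rewrite unitmx_mul unitmx_inv uV2.
pose toGL (A : 'M[K]_n) (uA : A \in unitmx) : GL K n := exist _ A uA.
pose g : GL3 K n := (toGL _ ug1, toGL _ ug2, toGL _ ug3).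
have gV : bigmx g = invmx V0 *m V.
  (* The products telescope: [g1 g2 = V0^-1 V2] and [g1 g2 g3 = V0^-1 V3]. *)
  rewrite -[V]hsubmxK -[lsubmx V]hsubmxK -[lsubmx (lsubmx V)]hsubmxK.
  rewrite !mul_mx_row mulVmx // /bigmx /=.
  by rewrite -!mulmxA !mulKVmx // mulmxA.
exists g => i j k h; rewrite M_det_cols // gV.
have us : uniq (column_seq n i j k).
  by apply: (sorted_uniq ltn_trans ltnn); exact: sorted_column_seq.
have [f inj_f Ef] := colsub_of_seq us (column_seq_bound h) (size_column_seq h).
rewrite /det_cols Ef -unitfE -unitmxE -mulmx_colsub unitmx_mul unitmx_inv uV0 /=.
exact: Vunit.
Qed.

(** * Rational functions with denominator nonzero at a fixed point *)

Section RationalAt.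
Variables (K : fieldType) (X : Type) (T : finType) (F : {set T}) (h : T -> X -> K).
Variable (x0 : X).

(** Denominators that are each nonzero somewhere on [X] may have a product vanishing identically;
    fixing the point [x0] gives closure under sums and products. *)
Definition rational_at (f : X -> K) : Prop :=
  exists P Q : {mpoly K[#|F|]},
    let ev (S : {mpoly K[#|F|]}) (x : X) := S.@[fun a => h (enum_val a) x] in
    ev Q x0 != 0 /\ (forall x, ev Q x != 0 -> f x = ev P x / ev Q x).

Lemma rational_at_function f : rational_at f -> rational_function_of F h f.
Proof. by move=> [P [Q [Q0 PQ]]]; exists P, Q; split=> //; exists x0. Qed.

Lemma rational_at_var t : t \in F -> rational_at (h t).
Proof.
move=> tF; exists 'X_(enum_rank_in tF t), 1 => /=; split=> [|x _].
  by rewrite meval1 oner_neq0.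
by rewrite mevalXU meval1 divr1 enum_rankK_in.
Qed.

Lemma rational_at_add f1 f2 :
  rational_at f1 -> rational_at f2 -> rational_at (fun x => f1 x + f2 x).
Proof.
move=> [P1 [Q1 /= [n1 e1]]] [P2 [Q2 /= [n2 e2]]].
exists (P1 * Q2 + P2 * Q1), (Q1 * Q2) => /=; rewrite mevalM mulf_neq0 //.
split=> // x; rewrite mevalD !mevalM mulf_eq0 negb_or => /andP[m1 m2].
by rewrite e1 // e2 // addf_div.
Qed.

Lemma rational_at_mul f1 f2 :
  rational_at f1 -> rational_at f2 -> rational_at (fun x => f1 x * f2 x).
Proof.
move=> [P1 [Q1 /= [n1 e1]]] [P2 [Q2 /= [n2 e2]]].
exists (P1 * P2), (Q1 * Q2) => /=; rewrite mevalM mulf_neq0 //.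
split=> // x; rewrite !mevalM mulf_eq0 negb_or => /andP[m1 m2].
by rewrite e1 // e2 // mulf_div.
Qed.

Lemma rational_at_quotient f e m :
  (forall x, f x * m x = e x) -> m x0 != 0 ->
  rational_at e -> rational_at m -> rational_at f.
Proof.
move=> fm m0 [P1 [Q1 /= [n1 e1]]] [P2 [Q2 /= [n2 e2]]].
(* The quotient is [P1 Q2 / (Q1 P2)]; the extra factor [Q2] forces [Q2] to be nonzero wherever [e2]
   is applied. *)
exists (P1 * Q2 * Q2), (Q1 * P2 * Q2) => /=; split.
  by rewrite !mevalM !mulf_neq0 //; apply: contraNneq m0 => P20; rewrite e2 // P20 mul0r.
move=> x; rewrite !mevalM !mulf_eq0 !negb_or -andbA => /and3P[q1 p2 q2].
have mx : m x != 0 by rewrite e2 // mulf_neq0 ?invr_eq0.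
apply: (mulIf mx); rewrite fm e1 // e2 //.
by field; rewrite q1 q2 p2.
Qed.

End RationalAt.

(** * Reduction to the two pairs of faces *)

Lemma rational_at_M (K : fieldType) (n : nat) (F : {set cube n}) (g0 : GL3 K n)
    (i j k : nat) :
  (i <= n)%N -> (j <= n)%N -> (k <= n)%N ->
  (inord i, inord j, inord k) \in F ->
  rational_at F (@M_at K n) g0 (@M K n i j k).
Proof.
move=> hi hj hk /(rational_at_var (@M_at K n) g0).
by rewrite /M_at /= !inordK.
Qed.

Lemma M_rational_k0_i0 (K : fieldType) (n : nat) (g0 : GL3 K n) :
  (forall i j k : nat, (i + j + k <= n)%N -> M i j k g0 != 0) ->
  forall i j k : nat, (i + j + k <= n)%N ->
    rational_at (faces_k0_i0 n) (@M_at K n) g0 (@M K n i j k).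
Proof.
move=> g0_neq0 i j k.
have [m] := ubnP (i + k); elim: m i j k => // m IH i j k hm hn.
have [face|/norP[i0 k0]] := boolP ((k == 0) || (i == 0))%N.
  apply: rational_at_M; try lia.
  by rewrite inE /= !inordK ?face ?andbT; lia.
(* The target becomes [(i+1, j, k+1)], of weight [i + k + 2]; the numerator entries have weight
   [i + k + 1] and the divisor [i + k]. *)
case: i k i0 k0 hm hn => [//|i] [//|k] _ _ hm hn.
apply: (@rational_at_quotient _ _ _ _ _ _ _
  (fun g => M i j.+1 k.+1 g * M i.+1 j k g + M i j k.+1 g * M i.+1 j.+1 k g)
  (@M K n i j.+1 k)).
- by move=> g; apply: octahedron_nat; lia.
- by apply: g0_neq0; lia.
- by apply: rational_at_add; apply: rational_at_mul; apply: IH; lia.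
- by apply: IH; lia.
Qed.

Lemma M_rational_j0_sum (K : fieldType) (n : nat) (g0 : GL3 K n) :
  (forall i j k : nat, (i + j + k <= n)%N -> M i j k g0 != 0) ->
  forall i j k : nat, (i + j + k <= n)%N ->
    rational_at (faces_j0_sum n) (@M_at K n) g0 (@M K n i j k).
Proof.
move=> g0_neq0 i j k.
(* On Delta^3(n) this measure is [n - (i + k)], so the recursion climbs in [i + k], opposite to the
   previous lemma. *)
have [m] := ubnP (n - (i + j + k) + j); elim: m i j k => // m IH i j k hm hn.
have [face|/norP[j0 sn]] := boolP ((j == 0) || (i + j + k == n))%N.
  apply: rational_at_M; try lia.
  by rewrite inE /= !inordK ?face ?andbT; lia.
(* Off the face, [i + (j+1) + k < n], hence [i + j + k + 2 <= n] and all entries of the recurrence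
   lie in Delta^3(n). *)
case: j j0 sn hm hn => [//|j] _ sn hm hn.
apply: (@rational_at_quotient _ _ _ _ _ _ _
  (fun g => M i j.+1 k.+1 g * M i.+1 j k g + M i j k.+1 g * M i.+1 j.+1 k g)
  (@M K n i.+1 j k.+1)).
- by move=> g; rewrite mulrC; apply: octahedron_nat; lia.
- by apply: g0_neq0; lia.
- by apply: rational_at_add; apply: rational_at_mul; apply: IH; lia.
- by apply: IH; lia.
Qed.

Theorem theorem4p20 (R : realType) (n : nat) :
  (forall (i j k : int) (g : GL3 R[i] n),
     M (i + 1) j (k + 1) g * M i (j + 1) k g =
     M i (j + 1) (k + 1) g * M (i + 1) j k g
     + M i j (k + 1) g * M (i + 1) (j + 1) k g) /\
  (forall i j k : int, in_Delta3 n i j k ->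
     rational_function_of (faces_k0_i0 n) (@M_at R[i] n) (@M R[i] n i j k) /\
     rational_function_of (faces_j0_sum n) (@M_at R[i] n) (@M R[i] n i j k)).
Proof.
split=> [i j k g|]; first exact: octahedron.
have [g0 g0_neq0] := generic_point R[i] n.
case=> [i|//] [j|//] [k|//] /and4P[_ _ _ h].
split; apply: (@rational_at_function _ _ _ _ _ g0).
  by apply: M_rational_k0_i0 => //; lia.
by apply: M_rational_j0_sum => //; lia.
Qed.
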